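(* Let $R=K[x_1,\ldots,x_n]$ be a standard graded polynomial ring over a field $K$, and let $I = (x_1^{a_1}, \dots, x_r^{a_r})\subseteq R$ be a monomial ideal generated by pure powers of variables, where $1\le r \le n$ and $a_1,\ldots,a_r\ge 1$. Then $$\mathrm{v}(\overline{I}) \le \mathrm{v}(I).$$
   Context: For a proper homogeneous ideal $I\subseteq R$, the v-number of $I$ is $$\mathrm{v}(I)=\min\{d\ge 0 : \text{there exist } f\in R_d \text{ and } \mathfrak p\in\operatorname{Ass}(I) \text{ such that } (I:f)=\mathfrak p\},$$ where $R_d$ is the space of homogeneous polynomials of degree $d$, $(I:f)=\{g\in R: gf\in I\}$, and $\operatorname{Ass}(I)$ is the set of associated primes of $R/I$. The integral closure $\overline{I}$ of an ideal $I$ is the ideal of all $x\in R$ satisfying an equation $x^m+a_1x^{m-1}+\cdots+a_m=0$ with $m\ge 1$ and $a_i\in I^i$. *)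

(* Defs.v *)
From mathcomp Require Import all_boot all_order all_algebra.
From mathcomp Require Import mpoly.

Set Implicit Arguments.
Unset Strict Implicit.
Unset Printing Implicit Defensive.

Import GRing.Theory.
Local Open Scope ring_scope.

(* Ideals are Prop-valued predicates, compared extensionally, since membership
   in an integral closure or in a colon ideal is not a boolean a priori. *)
Section Ideals.
Variable R : comNzRingType.
Implicit Types (S I p : R -> Prop) (f g x : R).

Definition is_ideal I : Prop :=
  [/\ I 0, forall x y, I x -> I y -> I (x + y) & forall c x, I x -> I (c * x)].

Definition is_prime_ideal p : Prop :=
  [/\ is_ideal p, ~ p 1 & forall x y, p (x * y) -> p x \/ p y].

Definition ideal_span S : R -> Prop := fun x =>
  exists (m : nat) (c s : 'I_m -> R),
    (forall i, S (s i)) /\ x = \sum_(i < m) c i * s i.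

(* For k = 0 the only generator is the empty product, so I^0 is the unit
   ideal. *)
Definition ideal_pow I (k : nat) : R -> Prop :=
  ideal_span (fun x => exists s : 'I_k -> R,
    (forall i, I (s i)) /\ x = \prod_(i < k) s i).

Definition integral_closure I : R -> Prop := fun x =>
  exists (m : nat) (a : nat -> R),
    [/\ (0 < m)%N,
        forall i, (1 <= i <= m)%N -> ideal_pow I i (a i) &
        x ^+ m + \sum_(1 <= i < m.+1) a i * x ^+ (m - i) = 0].

Definition colon I f : R -> Prop := fun g => I (g * f).

(* colon I g is the annihilator of the class of g in R/I. *)
Definition is_associated_prime I p : Prop :=
  is_prime_ideal p /\ exists g, forall x, p x <-> colon I g x.

End Ideals.

Section VNumber.
Variables (K : fieldType) (n : nat).
Implicit Types I p : {mpoly K[n]} -> Prop.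

Definition v_degree I (d : nat) : Prop :=
  exists (f : {mpoly K[n]}) p,
    [/\ f \is d.-homog, is_associated_prime I p &
        forall g, colon I f g <-> p g].

(* The v-number is given by its graph: is_vnumber I v reads "the minimum
   defining v(I) exists and equals v". *)
Definition is_vnumber I (v : nat) : Prop :=
  v_degree I v /\ forall d, v_degree I d -> (v <= d)%N.

Lemma is_vnumber_uniq I v w : is_vnumber I v -> is_vnumber I w -> v = w.
Proof.
move=> [Iv v_min] [Iw w_min]; apply/eqP.
by rewrite eqn_leq v_min // w_min.
Qed.

Definition pure_power_ideal (r : nat) (le_rn : (r <= n)%N) (a : 'I_r -> nat) :
    {mpoly K[n]} -> Prop :=
  ideal_span (fun g => exists i : 'I_r, g = 'X_(widen_ord le_rn i) ^+ a i).

End VNumber.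

Arguments pure_power_ideal K {n r} le_rn a _.

(* Main.v *)
Require Import Defs.
From HB Require Import structures.
From Stdlib Require Import Classical.
From mathcomp Require Import all_boot all_order all_algebra.
From mathcomp Require Import mpoly ring.

(** Let p = (x_1, ..., x_r) and let a_M be the largest exponent.  If (I : f) is
    prime then it contains p, so x_M f lies in I while f does not; looking at a
    monomial of f outside I gives deg f >= a_M - 1, hence v(I) >= a_M - 1.
    Conversely f = x_M^(a_M - 1) satisfies (cl I : f) = p, cl I being the
    integral closure, so v(cl I) <= a_M - 1.  The inclusion of p in (cl I : f)
    is the determinant trick for the module (x_1, ..., x_r)^k with k large;
    the other inclusion follows by specialising variables to 0. *)

Set Implicit Arguments.
Unset Strict Implicit.
Unset Printing Implicit Defensive.

Import GRing.Theory.
Local Open Scope ring_scope.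

(** * Generated ideals and ideal powers *)

Section IdealSpan.
Variable R : comNzRingType.
Implicit Types (S I P : R -> Prop) (x y : R).

Lemma ideal_sum I (T : Type) (s : seq T) (Q : pred T) (F : T -> R) :
  is_ideal I -> (forall i, Q i -> I (F i)) -> I (\sum_(i <- s | Q i) F i).
Proof. by case=> I0 ID _ IF; apply: big_ind. Qed.

Lemma ideal_span_ideal S : is_ideal (ideal_span S).
Proof.
split.
- exists 0%N, (fun=> 0), (fun=> 0); split; first by case.
  by rewrite big_ord0.
- move=> _ _ [m1 [c1 [s1 [Ss1 ->]]]] [m2 [c2 [s2 [Ss2 ->]]]].
  exists (m1 + m2)%N.
  exists (fun i => match split i with inl j => c1 j | inr j => c2 j end).
  exists (fun i => match split i with inl j => s1 j | inr j => s2 j end).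
  split; first by move=> i; case: split.
  rewrite big_split_ord; congr (_ + _); apply: eq_bigr => i _ /=.
    by rewrite (unsplitK (inl i)).
  by rewrite (unsplitK (inr i)).
move=> c _ [m [d [s [Ss ->]]]]; exists m, (fun i => c * d i), s; split=> //.
by rewrite mulr_sumr; apply: eq_bigr => i _; rewrite mulrA.
Qed.

Lemma mem_ideal_span S x : S x -> ideal_span S x.
Proof.
move=> Sx; exists 1%N, (fun=> 1), (fun=> x).
by split=> //; rewrite big_ord1 mul1r.
Qed.

Lemma ideal_span_sub S I :
  is_ideal I -> (forall x, S x -> I x) -> forall x, ideal_span S x -> I x.
Proof.
move=> idI SI _ [m [c [s [Ss ->]]]]; apply: ideal_sum => // i _.
by case: idI => _ _ IM; apply/IM/SI.
Qed.

Lemma ideal_pow_ideal I k : is_ideal (ideal_pow I k).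
Proof. exact: ideal_span_ideal. Qed.

Lemma ideal_pow0 I x : ideal_pow I 0 x.
Proof.
have [_ _ IM] := ideal_pow_ideal I 0; rewrite -[x]mulr1.
apply/IM/mem_ideal_span; exists (fun=> 0); split; first by case.
by rewrite big_ord0.
Qed.

Lemma mem_ideal_pow1 I x : I x -> ideal_pow I 1 x.
Proof.
by move=> Ix; apply: mem_ideal_span; exists (fun=> x); rewrite big_ord1.
Qed.

Lemma ideal_powM I j k x y :
  ideal_pow I j x -> ideal_pow I k y -> ideal_pow I (j + k) (x * y).
Proof.
have [I0 ID IM] := ideal_pow_ideal I (j + k) => Ix Iy.
refine (@ideal_span_sub _ (fun z => ideal_pow I (j + k) (z * y)) _ _ x Ix).
  split=> [|u v Iu Iv|c u Iu]; first by rewrite mul0r.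
  - by rewrite mulrDl; apply: ID.
  - by rewrite -mulrA; apply: IM.
move=> _ [s [Is ->]]; set u := \prod_(i < j) _.
refine (@ideal_span_sub _ (fun z => ideal_pow I (j + k) (u * z)) _ _ y Iy).
  split=> [|v w Iv Iw|c v Iv]; first by rewrite mulr0.
  - by rewrite mulrDr; apply: ID.
  - by rewrite mulrCA; apply: IM.
move=> _ [t [It ->]]; apply: mem_ideal_span.
exists (fun i => match split i with inl l => s l | inr l => t l end).
split; first by move=> i; case: split.
rewrite big_split_ord; congr (_ * _); apply: eq_bigr => i _ /=.
  by rewrite (unsplitK (inl i)).
by rewrite (unsplitK (inr i)).
Qed.

(** Each of the [k] factors of a generator of [I^k] contributes one factor [t]. This controls the
    coefficients of an integral equation after variables are specialised. *)
Lemma ideal_pow_morph_principal (R' : comNzRingType) (phi : {rmorphism R -> R'})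
    I (t : R') :
    (forall x, I x -> exists b, phi x = b * t) ->
  forall k x, ideal_pow I k x -> exists b, phi x = b * t ^+ k.
Proof.
move=> phiI k x Ix.
refine (@ideal_span_sub _ (fun z => exists b, phi z = b * t ^+ k) _ _ x Ix)
  => {x Ix} [|_ [s [Is ->]]].
  split=> [|x y [b bE] [c cE]|c x [b bE]].
  - by exists 0; rewrite rmorph0 mul0r.
  - by exists (b + c); rewrite rmorphD bE cE mulrDl.
  - by exists (phi c * b); rewrite rmorphM bE mulrA.
elim: k s Is => [|k IHk] s Is.
  by exists 1; rewrite big_ord0 rmorph1 mulr1.
have [b bE] := IHk (fun i => s (lift ord0 i)) (fun i => Is _).
have [c cE] := phiI _ (Is ord0).
by exists (c * b); rewrite big_ord_recl rmorphM bE cE exprS mulrACA.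
Qed.

End IdealSpan.

(** * Characteristic polynomials of matrices over an ideal *)

Section CharPoly.
Variables (R : comNzRingType) (I : R -> Prop).
Implicit Types p q : {poly R}.

(* The polynomials \sum_j c_j X^j with c_j in I^(k - j), j <= k: the degree k
   forms of the Rees algebra when X also has degree 1. *)
Definition pow_graded (k : nat) p : Prop :=
  forall j, ((j <= k)%N -> ideal_pow I (k - j) p`_j) /\ ((k < j)%N -> p`_j = 0).

Lemma pow_graded_closed k :
  [/\ pow_graded k 0,
      forall p q, pow_graded k p -> pow_graded k q -> pow_graded k (p + q) &
      forall c p, pow_graded k p -> pow_graded k (c *: p)].
Proof.
split=> [j|p q gp gq j|c p gp j].
- by rewrite coef0; split=> // _; case: (ideal_pow_ideal I (k - j)).
- rewrite coefD; have [[p1 p2] [q1 q2]] := (gp j, gq j); split=> h.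
    by have [_ ID _] := ideal_pow_ideal I (k - j); exact: ID (p1 h) (q1 h).
  by rewrite p2 // q2 // addr0.
rewrite coefZ; have [p1 p2] := gp j; split=> h.
  by have [_ _ IM] := ideal_pow_ideal I (k - j); apply/IM/p1.
by rewrite p2 // mulr0.
Qed.

Lemma pow_gradedM k l p q :
  pow_graded k p -> pow_graded l q -> pow_graded (k + l) (p * q).
Proof.
move=> gp gq j; rewrite coefM; split=> hj.
  apply: ideal_sum => [|i _]; first exact: ideal_pow_ideal.
  have [I0 _ _] := ideal_pow_ideal I (k + l - j).
  have [[p1 p2] [q1 q2]] := (gp i, gq (j - i)%N).
  have le_ij : (i <= j)%N by rewrite -ltnS.
  case: (leqP i k) => hi; last by rewrite p2 // mul0r.
  case: (leqP (j - i) l) => hji; last by rewrite q2 // mulr0.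
  have -> : (k + l - j = (k - i) + (l - (j - i)))%N.
    by rewrite addnBA // subnBA // addnAC subnK.
  by apply: ideal_powM; [apply: p1 | apply: q1].
apply: big1 => i _; case: (leqP i k) => hi; last first.
  by rewrite (gp i).2 // mul0r.
rewrite (gq (j - i)%N).2 ?mulr0 // ltn_subRL.
by apply: leq_ltn_trans hj; rewrite leq_add2r.
Qed.

Lemma pow_graded_prod N (F : 'I_N -> {poly R}) :
  (forall i, pow_graded 1 (F i)) -> pow_graded N (\prod_(i < N) F i).
Proof.
elim: N F => [|N IHN] F gF.
  rewrite big_ord0 => j; rewrite coef1; split=> [|].
    by rewrite leqn0 => /eqP->; apply: ideal_pow0.
  by rewrite lt0n => /negPf->.
by rewrite big_ord_recl; apply: (@pow_gradedM 1 N) => //; apply: IHN.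
Qed.

Hypothesis idI : is_ideal I.

(** In the Leibniz expansion every entry of ['X - B] is a form of degree 1: its constant term is in
    [I], its ['X]-coefficient in the unit ideal [I^0]. Products of [N] such forms have degree
    [N]. *)
Lemma char_poly_pow_graded N (B : 'M[R]_N) :
  (forall i j, I (B i j)) -> pow_graded N (char_poly B).
Proof.
move=> IB; rewrite /char_poly /determinant.
have [g0 gD gZ] := pow_graded_closed N.
apply: big_ind => // s _.
rewrite mulr_sign -scaler_sign; apply: gZ.
apply: pow_graded_prod => i j; rewrite !mxE coefB coefC coefMn coefX.
have [I0 _ IM] := idI.
case: j => [|[|j]]; split=> //=.
- rewrite mul0rn sub0r -mulN1r => _; apply/mem_ideal_pow1/IM/IB.
- by move=> _; apply: ideal_pow0.
- by move=> _; rewrite mul0rn subr0.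
Qed.

End CharPoly.

(* Determinant trick: the product y * m_e lies in I * M, M being the module
   generated by the m_e, so y is a root of the characteristic polynomial of a
   matrix with entries in I. *)
Lemma integral_closure_det (R : idomainType) (I : R -> Prop) (T : finType)
    (m : T -> R) (y : R) :
    is_ideal I -> (exists e, m e != 0) ->
    (forall e, exists b : T -> R,
       (forall t, I (b t)) /\ y * m e = \sum_t b t * m t) ->
  integral_closure I y.
Proof.
move=> idI [e0 me0] /fin_all_exists [B hB].
pose N := #|T|; pose A := \matrix_(i < N, j < N) B (enum_val i) (enum_val j).
pose v := \col_(i < N) m (enum_val i).
have N_gt0 : (0 < N)%N by apply/card_gt0P; exists e0.
have Av : (y%:M - A) *m v = 0.
  rewrite mulmxBl mul_scalar_mx; apply/matrixP => i j; rewrite !mxE (hB _).2.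
  rewrite (big_enum_val (fun t => B _ t * m t)) /=.
  by apply/eqP; rewrite subr_eq0; apply/eqP/eq_bigr => k _; rewrite !mxE.
(* The adjugate turns [Av] into [\det (y%:M - A) *: v = 0]; the nonzero entry [m e0] of [v] then
   cancels in the domain. *)
have det0 : \det (y%:M - A) = 0.
  have : \det (y%:M - A) *: v = 0.
    by rewrite -mul_scalar_mx -mul_adj_mx -mulmxA Av mulmx0.
  move/matrixP/(_ (enum_rank e0) 0); rewrite !mxE enum_rankK => /eqP.
  by rewrite mulf_eq0 (negPf me0) orbF => /eqP.
have root_y : (char_poly A).[y] = 0.
  rewrite -[_.[y]]/(horner_eval y _) /char_poly -det_map_mx -[RHS]det0.
  congr (\det _); apply/matrixP => i j; rewrite !mxE /= /horner_eval.
  rewrite hornerD hornerN.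
  by rewrite hornerC hornerMn hornerX.
have gA : pow_graded I N (char_poly A).
  by apply: char_poly_pow_graded => // i j; rewrite mxE; apply: (hB _).1.
(* The coefficient of degree [N - i] lies in [I^(N - (N - i)) = I^i], as an integral equation
   requires. *)
exists N, (fun i => (char_poly A)`_(N - i)); split=> //.
  move=> i /andP[_ iN].
  by have := (gA (N - i)%N).1 (leq_subr _ _); rewrite subKn.
rewrite -[RHS]root_y horner_coef size_char_poly big_ord_recr /= addrC.
have := monicP (char_poly_monic A); rewrite lead_coefE size_char_poly /= => ->.
rewrite mul1r; congr (_ + _).
rewrite big_add1 /= big_nat_rev /= big_mkord; apply: eq_bigr => i _.
by rewrite add0n subnSK // subKn // ltnW.
Qed.

(** * Pure power ideals and specialisation of variables *)

Section PurePowers.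
Variables (K : fieldType) (n r : nat) (le_rn : (r <= n)%N).
Implicit Types (a : 'I_r -> nat) (f g : {mpoly K[n]}) (m : 'X_{1..n}).

Local Notation w := (widen_ord le_rn).

Lemma widen_ord_eq i j : (w i == w j) = (i == j).
Proof. by []. Qed.

Lemma pure_power_ideal_ideal a : is_ideal (pure_power_ideal K le_rn a).
Proof. exact: ideal_span_ideal. Qed.

Lemma mem_pure_power a i : pure_power_ideal K le_rn a ('X_(w i) ^+ a i).
Proof. by apply: mem_ideal_span; exists i. Qed.

(** Exponents only grow under multiplication, and a monomial with [a i <= m (w i)] is divisible by a
    generator. *)
Lemma pure_powerP a g :
  pure_power_ideal K le_rn a g <->
  {in msupp g, forall m, [exists i, (a i <= m (w i))%N]}.
Proof.
have [I0 ID IM] := pure_power_ideal_ideal a; split=> [Ig|supp_g].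
  pose Q g := {in msupp g, forall m, [exists i, (a i <= m (w i))%N]}.
  refine (ideal_span_sub (I := Q) _ _ Ig).
    split=> [|g1 g2 Q1 Q2|c g1 Q1] m.
    - by rewrite -mpolyC0 msupp0.
    - by move/msuppD_le; rewrite mem_cat => /orP[/Q1|/Q2].
    move/msuppM_le/allpairsP => [[m1 m2] /= [_ /Q1/existsP[i le_i] ->]].
    apply/existsP; exists i.
    by rewrite mnmDE; apply: leq_trans le_i (leq_addl _ _).
  move=> _ [i ->] m; rewrite mpolyXn msuppX inE => /eqP->.
  by apply/existsP; exists i; rewrite mulmnE mnm1E eqxx mul1n.
rewrite [g]mpolyE big_seq; apply: ideal_sum => [|m /supp_g/existsP[i le_i]].
  by split.
rewrite -mul_mpolyC; apply: (IM).
have le_m : (U_(w i) *+ a i <= m)%MM.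
  apply/mnm_lepP => j; rewrite mulmnE mnm1E.
  by case: eqP => [<-|_]; rewrite ?mul1n ?mul0n.
by rewrite -(submK le_m) mpolyXD -mpolyXn; apply/IM/mem_pure_power.
Qed.

(** An endomorphism rather than a map to fewer variables, so that successive specialisations compose
    within one ring. *)
Definition kill_vars (P : pred 'I_n) : {mpoly K[n]} -> {mpoly K[n]} :=
  comp_mpoly [tuple (if P i then 0 else 'X_i) | i < n].

HB.instance Definition _ P := GRing.RMorphism.on (kill_vars P).

Lemma kill_varsX P i : kill_vars P 'X_i = if P i then 0 else 'X_i.
Proof. by rewrite /kill_vars comp_mpolyXU -tnth_nth tnth_mktuple. Qed.

Lemma kill_varsC P c : kill_vars P c%:MP = c%:MP.
Proof. exact: comp_mpolyC. Qed.

Local Notation var_ideal := (pure_power_ideal K le_rn (fun=> 1%N)).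
Local Notation kill := (kill_vars (fun i => (i < r)%N)).

(** Modulo the ideal, [kill] is the identity: this holds on constants and variables and passes to
    products and sums. Being the kernel of a map to a domain makes the ideal prime. *)
Lemma var_idealP g : var_ideal g <-> kill g = 0.
Proof.
have [I0 ID IM] := pure_power_ideal_ideal (fun=> 1%N); split=> [Ig|].
  refine (ideal_span_sub (I := fun g => kill g = 0) _ _ Ig).
    split=> [|g1 g2 e1 e2|c g1 e1]; first by rewrite rmorph0.
    - by rewrite rmorphD /= e1 e2 addr0.
    - by rewrite rmorphM /= e1 mulr0.
  by move=> _ [i ->]; rewrite expr1 kill_varsX /= ltn_ord.
suff: var_ideal (g - kill g) by move=> + kg0; rewrite kg0 subr0.
have killM h1 h2 : var_ideal (h1 - kill h1) -> var_ideal (h2 - kill h2) ->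
    var_ideal (h1 * h2 - kill (h1 * h2)).
  move=> H1 H2; rewrite rmorphM /=.
  have -> : h1 * h2 - kill h1 * kill h2
      = h2 * (h1 - kill h1) + kill h1 * (h2 - kill h2).
    by rewrite !mulrBr addrA (mulrC h2 h1) (mulrC h2) subrK.
  by apply: (ID); apply: (IM).
rewrite {1 2}[g]mpolyE rmorph_sum /= -sumrB.
apply: ideal_sum => [|m _]; first by split.
rewrite -mul_mpolyC; apply: (killM); first by rewrite kill_varsC subrr.
rewrite mpolyXE_id.
elim/big_ind: _ => [|h1 h2|i _]; first by rewrite rmorph1 subrr.
  exact: killM.
elim: (m i) => [|k IHk]; first by rewrite expr0 rmorph1 subrr.
rewrite exprS; apply: killM => //; rewrite kill_varsX.
case: ifP => [lt_ir|_]; last by rewrite subrr.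
have -> : i = w (Ordinal lt_ir) by apply: val_inj.
by rewrite subr0; apply: (mem_pure_power (fun=> 1%N)).
Qed.

Lemma var_ideal_prime : is_prime_ideal var_ideal.
Proof.
split; first exact: pure_power_ideal_ideal.
  by move/var_idealP/eqP; rewrite rmorph1 oner_eq0.
move=> g h /var_idealP/eqP; rewrite rmorphM /= mulf_eq0.
by case/orP=> /eqP/var_idealP; [left|right].
Qed.

Lemma v_degree_of_colon (J : {mpoly K[n]} -> Prop) d f :
    f \is d.-homog -> (forall g, J (g * f) <-> var_ideal g) ->
  v_degree J d.
Proof.
move=> homf Jf; exists f, var_ideal; split=> //; split.
  exact: var_ideal_prime.
by exists f => g; split=> /Jf.
Qed.

(** Guarantees that v(I) exists. Multiplying by the witness ['X_[mu]] raises the exponent of [x_i]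
    by [a i - 1], so the test [a i <= _] becomes [0 < _]. *)
Lemma v_degree_pure_power a :
    (forall i, (0 < a i)%N) ->
  v_degree (pure_power_ideal K le_rn a) (\sum_i (a i).-1).
Proof.
move=> a_gt0; pose mu : 'X_{1..n} := (\sum_i U_(w i) *+ (a i).-1)%MM.
have muE i : mu (w i) = (a i).-1.
  rewrite mnm_sumE (bigD1 i) //= mulmnE mnm1E eqxx mul1n big1 ?addn0 // => j ji.
  by rewrite mulmnE mnm1E widen_ord_eq (negPf ji).
apply: (v_degree_of_colon (f := 'X_[mu])) => [|g].
  rewrite dhomogX /= mdeg_sum; apply/eqP/eq_bigr => i _.
  by rewrite /= mdegMn mdeg1 mul1n.
have leE m i : (a i <= (mu + m)%MM (w i))%N = (0 < m (w i))%N.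
  by rewrite mnmDE muE -{1}(prednK (a_gt0 i)) -addn1 leq_add2l.
split=> /pure_powerP Ig; apply/pure_powerP => m.
  move=> mg; have : (mu + m)%MM \in msupp (g * 'X_[mu]).
    by rewrite mcoeff_msupp mcoeffMX -mcoeff_msupp.
  by case/Ig/existsP=> i; rewrite leE => lt_i; apply/existsP; exists i.
rewrite (perm_mem (msuppMX _ _)) => /mapP[k /Ig/existsP[i lt_i] ->].
by apply/existsP; exists i; rewrite leE.
Qed.

Lemma v_degree_pure_power_ge a d :
    v_degree (pure_power_ideal K le_rn a) d ->
  forall i, ((a i).-1 <= d)%N.
Proof.
have [I0 ID IM] := pure_power_ideal_ideal a.
move=> [f [p [/dhomogP homf [[[_ _ pM] p1 pP] _] fp]]] i.
(* The power [x_i^(a_i)] multiplies [f] into the ideal, hence lies in the prime [p]. *)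
have pX : p 'X_(w i).
  have : p ('X_(w i) ^+ a i).
    by apply/fp; rewrite /colon mulrC; apply/IM/mem_pure_power.
  by elim: (a i) => [//|k IHk]; rewrite exprS => /pP[|/IHk].
have /pure_powerP IXf : pure_power_ideal K le_rn a (f * 'X_(w i)).
  by rewrite mulrC; apply/fp.
have nIf : ~ pure_power_ideal K le_rn a f.
  by move=> If; apply/p1/fp; rewrite /colon mul1r.
case: (boolP (all (fun m => [exists i, (a i <= m (w i))%N]) (msupp f))).
  by move/allP => H; case: nIf; apply/pure_powerP.
(* All exponents of [m] are below the bounds [a], yet [x_i * m] reaches one of them; only index [i]
   changed, so [a i <= m (w i) + 1]. *)
case/allPn=> m mf /existsPn nm.
have : (U_(w i) + m)%MM \in msupp (f * 'X_(w i)).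
  by rewrite mcoeff_msupp mcoeffMX -mcoeff_msupp.
case/IXf/existsP => j; rewrite mnmDE mnm1E widen_ord_eq.
case: eqP => [<-|_]; last by rewrite (negPf (nm j)).
rewrite add1n => le_ai; rewrite -(homf _ mf).
rewrite /= -ltnS; apply: leq_ltn_trans (_ : m (w i) < _)%N.
  by rewrite -subn1 leq_subLR.
by rewrite ltnS mdegE (bigD1 (w i)) //= leq_addr.
Qed.

Lemma kill_vars_comp (P Q : pred 'I_n) g :
  subpred P Q -> kill_vars Q (kill_vars P g) = kill_vars Q g.
Proof.
move=> sPQ; rewrite [g]mpolyE (rmorph_sum (kill_vars P)).
rewrite !(rmorph_sum (kill_vars Q)) /=; apply: eq_bigr => m _.
rewrite -mul_mpolyC !rmorphM /= !kill_varsC; congr (_ * _).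
rewrite mpolyXE_id !rmorph_prod /=; apply: eq_bigr => i _.
rewrite !rmorphXn /= !kill_varsX; case: ifP => [/sPQ->|_].
  by rewrite rmorph0.
by rewrite kill_varsX.
Qed.

(** * The colon of the integral closure by [x_M^(a_M - 1)] *)

Section Closure.
Variables (a : 'I_r -> nat) (M : 'I_r).
Hypotheses (a_gt0 : forall i, (0 < a i)%N) (a_max : forall i, (a i <= a M)%N).

Local Notation I := (pure_power_ideal K le_rn a).
Local Notation f := ('X_(w M) ^+ (a M).-1 : {mpoly K[n]}).

(* Killing the variables x_i with i < r other than x_M turns I into a principal
   ideal (x_M^A); after cancelling x_M^((A-1)m), the integral equation of g * f
   makes g^m a multiple of x_M modulo the killed variables. *)
Lemma closure_colon_sub g : integral_closure I (g * f) -> var_ideal g.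
Proof.
pose P (i : 'I_n) := (i < r)%N && (i != w M).
pose phi : {rmorphism {mpoly K[n]} -> {mpoly K[n]}} := kill_vars P.
pose A := a M; pose x : {mpoly K[n]} := 'X_(w M).
have phix : phi x = x by rewrite /phi /= kill_varsX /P eqxx andbF.
have phiI h : I h -> exists b, phi h = b * x ^+ A.
  move=> Ih.
  refine (ideal_span_sub (I := fun h => exists b, phi h = b * x ^+ A) _ _ Ih).
    split=> [|y z [b bE] [c cE]|c y [b bE]].
    - by exists 0; rewrite rmorph0 mul0r.
    - by exists (b + c); rewrite rmorphD /= bE cE mulrDl.
    - by exists (phi c * b); rewrite rmorphM /= bE mulrA.
  move=> _ [i ->]; rewrite rmorphXn /phi /= kill_varsX /P /= ltn_ord.
  rewrite widen_ord_eq.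
  case: eqP => [->|_] /=; first by exists 1; rewrite mul1r.
  by exists 0; rewrite expr0n eqn0Ngt a_gt0 mul0r.
case=> m [c [m_gt0 Ic /(congr1 phi)]]; rewrite rmorphD rmorph0 rmorph_sum /=.
have phiy : phi (g * f) = phi g * x ^+ A.-1 by rewrite rmorphM rmorphXn /= phix.
rewrite rmorphXn /= phiy.
(* The [i]-th term carries [x] to the power [A i + (A - 1)(m - i) = (A - 1) m + i], and [i >= 1]
   leaves a spare factor [x]. *)
have [h ->] : exists h, \sum_(1 <= i < m.+1) phi (c i * (g * f) ^+ (m - i)) =
    x ^+ (A.-1 * m) * (x * h).
  rewrite big_nat.
  apply: (big_ind (fun z => exists h, z = x ^+ (A.-1 * m) * (x * h))).
  - by exists 0; rewrite !mulr0.
  - by move=> _ _ [h1 ->] [h2 ->]; exists (h1 + h2); rewrite !mulrDr.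
  move=> i /andP[i_gt0]; rewrite ltnS => le_im.
  have [|b bE] := ideal_pow_morph_principal phiI (Ic i _).
    by rewrite i_gt0.
  rewrite rmorphM rmorphXn /= bE phiy.
  exists (b * phi g ^+ (m - i) * x ^+ i.-1).
  have -> : x ^+ (A.-1 * m) = x ^+ (A.-1 * i) * x ^+ (A.-1 * (m - i)).
    by rewrite -exprD -mulnDr subnKC.
  have xi : x ^+ i = x * x ^+ i.-1 by rewrite -exprS prednK.
  have xAi : x ^+ (A * i) = x ^+ (A.-1 * i) * x ^+ i.
    by rewrite -exprD addnC -mulSn prednK ?a_gt0.
  by rewrite exprMn -!exprM xAi xi; ring.
(* Cancelling the power of [x] gives [phi g ^+ m + x * h = 0]; applying [kill], which sends [x] to
   0, leaves [kill g ^+ m = 0]. *)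
rewrite exprMn -exprM mulrC -mulrDr => /eqP; rewrite mulf_eq0 expf_eq0.
rewrite -msupp_eq0 msuppX andbF => /eqP/(congr1 kill).
rewrite rmorph0 rmorphD rmorphM rmorphXn /= kill_varsX /= ltn_ord mul0r addr0.
rewrite kill_vars_comp => [/eqP|l /andP[] //].
by rewrite expf_eq0 m_gt0 => /eqP/var_idealP.
Qed.

Local Notation degS m := (\sum_(j < r) (m : 'X_{1..n}) (w j))%N.

(** Extracts from [E] a generator of [(x_1, ..., x_r)^k], one variable at a time: equality of
    [degS e] and [mdeg e] excludes the variables beyond the first [r]. *)
Lemma degS_sub (E : 'X_{1..n}) k : (k <= degS E)%N ->
  exists e : 'X_{1..n}, [/\ (e <= E)%MM, degS e = k & mdeg e = k].
Proof.
elim: k => [_|k IHk lt_kE].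
  exists 0%MM; split; last exact: mdeg0.
    by apply/mnm_lepP => i; rewrite mnm0E.
  by apply: big1 => i _; rewrite mnm0E.
have [e [le_eE degSe mdege]] := IHk (ltnW lt_kE).
have [j lt_j] : exists j, (e (w j) < E (w j))%N.
  apply/existsP; apply: contraLR lt_kE => /existsPn H.
  by rewrite -leqNgt -degSe; apply: leq_sum => i _; rewrite leqNgt.
exists (U_(w j) + e)%MM; split.
- apply/mnm_lepP => i; rewrite mnmDE mnm1E.
  by case: eqP => [<-|_]; last exact: (mnm_lepP le_eE).
- rewrite -degSe (bigD1 j) //= [RHS](_ : _ = (\sum_(i < r) e (w i)).+1)%N //.
  rewrite [in RHS](bigD1 j) //= mnmDE mnm1E eqxx add1n addSn.
  congr (_ + _).+1%N.
  by apply: eq_bigr => i ij; rewrite mnmDE mnm1E widen_ord_eq eq_sym (negPf ij).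
- by rewrite mdegD mdeg1 mdege.
Qed.

(** For each generator [x^e] of [(x_1, ..., x_r)^k], the monomial [x_i * f * x^e] is some
    [x_j^(a_j)] times a multiple of another such generator, so the determinant trick applies. *)
Lemma closure_colon_sup g : var_ideal g -> integral_closure I (g * f).
Proof.
move=> gV; pose k := (\sum_j a j)%N.
pose T := 'X_{1..n < k.+1}.
pose in_gen (e : 'X_{1..n}) := (degS e == k) && (mdeg e == k).
(* Indices e that are not exponents of generators of (x_1, ..., x_r)^k get the
   redundant generator 0, which keeps the index type T simple. *)
pose gen (e : T) : {mpoly K[n]} := if in_gen e then 'X_[e] else 0.
have [I0 ID IM] := pure_power_ideal_ideal a.
(* [IG] is the product of [I] with the module spanned by [gen]. *)
pose IG h := exists b : T -> {mpoly K[n]},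
  (forall t, I (b t)) /\ h = \sum_t b t * gen t.
have idIG : is_ideal IG.
  split=> [|_ _ [b [Ib ->]] [c [Ic ->]]|c _ [b [Ib ->]]].
  - by exists (fun=> 0); split=> //; rewrite big1 // => t _; rewrite mul0r.
  - exists (fun t => b t + c t); split=> [t|]; first exact: ID.
    by rewrite -big_split; apply: eq_bigr => t _; rewrite mulrDl.
  - exists (fun t => c * b t); split=> [t|]; first exact: IM.
    by rewrite mulr_sumr; apply: eq_bigr => t _; rewrite mulrA.
have IG_gen c (e : 'X_{1..n}) : I c -> in_gen e -> IG (c * 'X_[e]).
  move=> Ic ge; have lt_e : (mdeg e < k.+1)%N by case/andP: (ge) => _ /eqP->.
  exists (fun t => if t == BMultinom lt_e then c else 0); split=> [t|].
    by case: ifP.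
  rewrite (bigD1 (BMultinom lt_e)) //= eqxx /gen /= ge big1 ?addr0 //.
  move=> t /negPf->.
  by rewrite mul0r.
apply: (integral_closure_det (m := gen)) => //.
  have lt_e : (mdeg (U_(w M) *+ k) < k.+1)%N by rewrite mdegMn mdeg1 mul1n.
  exists (BMultinom lt_e).
  rewrite /gen /in_gen /= mdegMn mdeg1 mul1n eqxx andbT.
  rewrite (bigD1 M) //= mulmnE mnm1E eqxx mul1n big1 ?addn0 ?eqxx.
    by rewrite -msupp_eq0 msuppX.
  by move=> j jM; rewrite mulmnE mnm1E widen_ord_eq eq_sym (negPf jM).
move=> e; rewrite -/(IG _).
refine (ideal_span_sub (I := fun h => IG (h * f * gen e)) _ _ gV).
  have [G0 GD GM] := idIG; split=> [|h1 h2|c h]; first by rewrite !mul0r.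
  - by rewrite !mulrDl; apply: GD.
  - by rewrite -2!mulrA mulrA -mulrA => /(GM c); rewrite !mulrA.
move=> _ [i ->]; rewrite /gen; case: ifP => [|_]; last first.
  by rewrite mulr0; case: idIG.
case/andP=> /eqP degSe _.
rewrite expr1 mpolyXn -!mpolyXD; set E := (_ + _)%MM.
have degSE : degS E = (a M + k)%N.
  rewrite /E; under eq_bigr do rewrite !mnmDE.
  rewrite !big_split /= degSe; congr (_ + _)%N.
  rewrite (bigD1 i) //= mnm1E eqxx big1 => [|j ji]; last first.
    by rewrite mnm1E widen_ord_eq eq_sym (negPf ji).
  rewrite (bigD1 M) //= mulmnE mnm1E eqxx big1 => [|j ji]; last first.
    by rewrite mulmnE mnm1E widen_ord_eq eq_sym (negPf ji).
  by rewrite !addn0 mul1n add1n prednK.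
(* Pigeonhole, which explains the choice of [k]: if all exponents were below the [a j], then
   [degS E] would be at most [k], but it is [a M + k]. *)
have [j le_j] : exists j, (a j <= E (w j))%N.
  apply/existsP; apply: contraT => /existsPn H.
  suff : (degS E <= k)%N.
    by rewrite degSE -[X in (_ <= X)%N]add0n leq_add2r leqNgt a_gt0.
  by apply: leq_sum => j _; rewrite ltnW // ltnNge.
have le_jE : (U_(w j) *+ a j <= E)%MM.
  apply/mnm_lepP => l; rewrite mulmnE mnm1E.
  by case: eqP => [<-|_]; rewrite ?mul1n ?mul0n.
(* Maximality of [a M] enters here: the remaining degree is [a M + k - a j]. *)
have degSE1 : (k <= degS (E - U_(w j) *+ a j)%MM)%N.
  rewrite -(leq_add2r (a j)).
  apply: (@leq_trans (degS E)); first by rewrite degSE addnC leq_add2r.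
  rewrite -{1}(submK le_jE); under eq_bigr do rewrite mnmDE.
  rewrite big_split leq_add2l (bigD1 j) //= mulmnE mnm1E eqxx mul1n.
  rewrite big1 ?addn0 //.
  by move=> l lj; rewrite mulmnE mnm1E widen_ord_eq eq_sym (negPf lj).
have [e' [le_e' degSe' mdege']] := degS_sub degSE1.
rewrite -(submK le_jE) -(submK le_e') addmC mpolyXD mpolyXD mulrA.
apply: IG_gen; last by rewrite /in_gen degSe' mdege' eqxx.
by rewrite -mpolyXn mulrC; apply/IM/mem_pure_power.
Qed.

Lemma v_degree_closure : v_degree (integral_closure I) (a M).-1.
Proof.
apply: (v_degree_of_colon (f := f)) => [|g].
  by rewrite mpolyXn dhomogX /= mdegMn mdeg1 mul1n.
by split; [exact: closure_colon_sub | exact: closure_colon_sup].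
Qed.

End Closure.
End PurePowers.

(** [v_degree] is not a boolean predicate, so the least degree is reached by strong induction with
    excluded middle. *)
Lemma ex_vnumber (K : fieldType) (n : nat) (J : {mpoly K[n]} -> Prop) d :
  v_degree J d -> exists2 v, is_vnumber J v & (v <= d)%N.
Proof.
elim/ltn_ind: d => d IHd Jd.
case: (classic (exists2 e, v_degree J e & (e < d)%N)) => [[e Je lt_ed]|no_lt].
  have [v Jv le_ve] := IHd e lt_ed Je.
  by exists v => //; apply: leq_trans le_ve (ltnW lt_ed).
exists d => //; split=> // e Je; rewrite leqNgt; apply/negP => lt_ed.
by case: no_lt; exists e.
Qed.

Theorem proposition3p5 (K : fieldType) (n r : nat) (r_gt0 : (0 < r)%N)
    (le_rn : (r <= n)%N) (a : 'I_r -> nat)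
    (a_gt0 : forall i : 'I_r, (0 < a i)%N) :
  exists v vbar : nat,
    [/\ is_vnumber (pure_power_ideal K le_rn a) v,
        is_vnumber (integral_closure (pure_power_ideal K le_rn a)) vbar &
        (vbar <= v)%N].
Proof.
have [M _ a_max] := arg_maxnP a (isT : xpredT (Ordinal r_gt0)).
have [v v_min _] := ex_vnumber (v_degree_pure_power K le_rn a_gt0).
have [|vbar vbar_min le_vbar] :=
  ex_vnumber (v_degree_closure K le_rn a_gt0 (M := M) _).
  by move=> i; apply: a_max.
exists v, vbar; split=> //; apply: leq_trans le_vbar _.
exact: v_degree_pure_power_ge v_min.1 M.
Qed.
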